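(* The normal subgroup $[\rho_2(\Gamma),\rho_2(\Gamma)]\lhd\rho_2(\Gamma)$ is of index at most three.
   Context: Commutators are $[x,y]=xyx^{-1}y^{-1}$, and $[G,G]$ is the commutator subgroup of a group $G$. $\Gamma=\langle g_1,g_3\mid [g_3,g_1^{-1}]g_3=g_1[g_3,g_1^{-1}]\rangle$ is the fundamental group of the figure eight knot complement. $\mathbf{SU}(2,1)$ is the group of complex $3\times 3$ matrices of determinant one preserving the Hermitian form $\langle Z,W\rangle=Z_1\overline{W}_3+Z_2\overline{W}_2+Z_3\overline{W}_1$. The representation $\rho_2:\Gamma\to\mathbf{SU}(2,1)$ is given by $$\rho_2(g_1)=\begin{pmatrix}1&1&-\frac12-\frac{\sqrt7}{2}i\\0&1&-1\\0&0&1\end{pmatrix},\qquad \rho_2(g_3)=\begin{pmatrix}1&0&0\\-1&1&0\\-\frac12+\frac{\sqrt7}{2}i&1&1\end{pmatrix}.$$ *)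

(* Defs.v *)
From HB Require Import structures.
From mathcomp Require Import all_boot all_order all_algebra.
From mathcomp Require Import boolp classical_sets functions cardinality reals.
From mathcomp Require Import generic_quotient complex ring.

Set Implicit Arguments.
Unset Strict Implicit.
Unset Printing Implicit Defensive.

Import Order.TTheory GRing.Theory Num.Theory.

Local Open Scope classical_set_scope.
Local Open Scope card_scope.
Local Open Scope quotient_scope.
Local Open Scope group_scope.

Section Subgroups.
Variable G : groupType.
Implicit Types (A N K : set G) (x y : G).

(* This is not MathComp's [~ x, y], which is x^-1 * y^-1 * x * y. *)
Definition comm x y : G := x * y * x^-1 * y^-1.

Definition is_subgroup K : Prop := group_closed [in K].

Lemma is_subgroupP K :
  is_subgroup K <-> K 1 /\ (forall x y, K x -> K y -> K (x * y^-1)).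
Proof.
split=> -[K1 Kdiv]; split; [exact/set_mem | | exact/mem_set | ].
  by move=> x y Kx Ky; apply/set_mem/Kdiv; apply/mem_set.
by move=> x y /set_mem Kx /set_mem Ky; apply/mem_set/Kdiv.
Qed.

Definition subgroup_gen A : set G := smallest is_subgroup A.

Definition commutator_subgroup K : set G :=
  subgroup_gen [set comm p.1 p.2 | p in K `*` K].

Definition normal_subgroup N K : Prop :=
  [/\ is_subgroup K, is_subgroup N, N `<=` K &
      forall x y, K x -> N y -> N (x * y * x^-1)].

Definition left_cosets K N : set (set G) :=
  [set [set x * y | y in N] | x in K].

Definition index_at_most K N (n : nat) : Prop :=
  left_cosets K N #<= `I_n.

End Subgroups.

Section Presentation.
Variable X : choiceType.

(* The letter (x, true) stands for x, and (x, false) for its inverse. *)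
Definition word := seq (X * bool).
Implicit Types u v w : word.

Definition word_gen (x : X) : word := [:: (x, true)].

Definition word_inv u : word := rev [seq (a.1, ~~ a.2) | a <- u].

Definition word_comm u v : word := u ++ v ++ word_inv u ++ word_inv v.

Variable rels : word -> word -> Prop.

(* The congruence on words whose quotient is the group with generators X and
   relations u = v for rels u v. *)
Inductive word_eq : word -> word -> Prop :=
| word_eq_refl u : word_eq u u
| word_eq_sym u v : word_eq u v -> word_eq v u
| word_eq_trans u v w : word_eq u v -> word_eq v w -> word_eq u w
| word_eq_cat u u' v v' :
    word_eq u u' -> word_eq v v' -> word_eq (u ++ v) (u' ++ v')
| word_eq_cancel x b : word_eq [:: (x, b); (x, ~~ b)] [::]
| word_eq_rel u v : rels u v -> word_eq u v.

Definition word_eqb : rel word := fun u v => `[< word_eq u v >].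

Lemma word_eqb_equiv : equiv_class_of word_eqb.
Proof.
split=> [u|u v|v u w].
- by apply/asboolP/word_eq_refl.
- by apply/asboolP/asboolP; apply: word_eq_sym.
- by move=> /asboolP uv /asboolP vw; apply/asboolP/(word_eq_trans uv vw).
Qed.

Canonical word_equiv := EquivRelPack word_eqb_equiv.

Definition presented_group : Type := {eq_quot word_equiv}.

HB.instance Definition _ := Choice.on presented_group.
HB.instance Definition _ := Quotient.on presented_group.

Local Notation pi := (\pi_presented_group).

Definition pres_one : presented_group := pi [::].
Definition pres_mul (a b : presented_group) : presented_group :=
  pi (repr a ++ repr b).
Definition pres_inv (a : presented_group) : presented_group :=
  pi (word_inv (repr a)).

Lemma pres_piP u v : pi u = pi v <-> word_eq u v.
Proof. by split=> [/eqmodP/asboolP //|uv]; apply/eqmodP/asboolP. Qed.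

Lemma word_invK : involutive word_inv.
Proof.
move=> u; rewrite /word_inv map_rev revK -map_comp map_id_in // => -[x b] _ /=.
by rewrite negbK.
Qed.

Lemma word_inv_cat u v : word_inv (u ++ v) = word_inv v ++ word_inv u.
Proof. by rewrite /word_inv map_cat rev_cat. Qed.

Lemma word_eq_mulV u : word_eq (u ++ word_inv u) [::].
Proof.
elim: u => [|[x b] u IHu]; first exact: word_eq_refl.
rewrite -cat1s word_inv_cat -catA (catA u).
apply: (@word_eq_trans _ ([:: (x, b)] ++ [::] ++ word_inv [:: (x, b)])).
  by do 2?[apply: word_eq_cat => //]; apply: word_eq_refl.
exact: word_eq_cancel.
Qed.

Lemma word_eq_inv u v : word_eq u v -> word_eq (word_inv u) (word_inv v).
Proof.
move=> uv.
have uV : word_eq (word_inv u ++ u) [::].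
  by rewrite -{2}(word_invK u); apply: word_eq_mulV.
apply: (@word_eq_trans _ (word_inv u ++ v ++ word_inv v)).
  rewrite -{1}(cats0 (word_inv u)); apply: word_eq_cat; first exact: word_eq_refl.
  exact/word_eq_sym/word_eq_mulV.
rewrite catA -{2}(cat0s (word_inv v)); apply: word_eq_cat.
  apply: (word_eq_trans _ uV); apply: word_eq_cat (word_eq_refl _) _.
  exact: word_eq_sym.
exact: word_eq_refl.
Qed.

Lemma word_eq_repr u : word_eq (repr (pi u)) u.
Proof. by apply/pres_piP; rewrite reprK. Qed.

Lemma pres_mulE u v : pres_mul (pi u) (pi v) = pi (u ++ v).
Proof. by apply/pres_piP/word_eq_cat; apply: word_eq_repr. Qed.

Lemma pres_invE u : pres_inv (pi u) = pi (word_inv u).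
Proof. by apply/pres_piP/word_eq_inv/word_eq_repr. Qed.

Lemma pres_mulA : associative pres_mul.
Proof.
move=> a b c; rewrite -[a]reprK -[b]reprK -[c]reprK.
by rewrite (pres_mulE (repr b)) (pres_mulE (repr a) (repr b)) !pres_mulE catA.
Qed.

Lemma pres_mul1 : left_id pres_one pres_mul.
Proof. by move=> a; rewrite -[a]reprK pres_mulE. Qed.

Lemma pres_mulr1 : right_id pres_one pres_mul.
Proof. by move=> a; rewrite -[a]reprK pres_mulE cats0. Qed.

Lemma pres_mulV : left_inverse pres_one pres_inv pres_mul.
Proof.
move=> a; rewrite -[a]reprK pres_invE pres_mulE; apply/pres_piP.
rewrite -{2}(word_invK (repr a)); exact: word_eq_mulV.
Qed.

Lemma pres_mulrV : right_inverse pres_one pres_inv pres_mul.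
Proof.
move=> a; rewrite -[a]reprK pres_invE pres_mulE; apply/pres_piP.
exact: word_eq_mulV.
Qed.

HB.instance Definition _ := isGroup.Build presented_group
  pres_mulA pres_mul1 pres_mulr1 pres_mulV pres_mulrV.

Definition pres_gen (x : X) : presented_group := pi (word_gen x).

Section Lift.
Variables (H : groupType) (f : X -> H).

Definition word_eval u : H :=
  foldr (fun a h => (if a.2 then f a.1 else (f a.1)^-1) * h) 1 u.

Lemma word_eval_cat u v : word_eval (u ++ v) = word_eval u * word_eval v.
Proof. by elim: u => [|a u IHu] /=; rewrite ?mul1g // IHu mulgA. Qed.

Lemma word_eval_gen x : word_eval (word_gen x) = f x.
Proof. by rewrite /= mulg1. Qed.

Lemma word_eval_inv u : word_eval (word_inv u) = (word_eval u)^-1.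
Proof.
elim: u => [|[x b] u IHu]; first by rewrite /= invg1.
rewrite -cat1s word_inv_cat !word_eval_cat IHu invgM; congr (_ * _).
by case: b; rewrite /= !mulg1 ?invgK.
Qed.

Lemma word_eval_comm u v :
  word_eval (word_comm u v) = comm (word_eval u) (word_eval v).
Proof. by rewrite !word_eval_cat !word_eval_inv /comm !mulgA. Qed.

Definition respects_rels : Prop :=
  forall u v, rels u v -> word_eval u = word_eval v.

Hypothesis f_rels : respects_rels.

Lemma word_eval_eq u v : word_eq u v -> word_eval u = word_eval v.
Proof.
elim=> {u v} [u|u v _ ->|u v w _ -> _ ->|u u' v v' _ Hu _ Hv|x b|u v /f_rels] //.
- by rewrite !word_eval_cat Hu Hv.
- by case: b; rewrite /= mulg1 ?mulgV ?mulVg.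
Qed.

Definition pres_lift of respects_rels := fun a : presented_group =>
  word_eval (repr a).

Local Notation lift := (pres_lift f_rels).

Lemma pres_lift_pi u : lift (pi u) = word_eval u.
Proof. exact/word_eval_eq/word_eq_repr. Qed.

Lemma pres_lift_gen x : lift (pres_gen x) = f x.
Proof. by rewrite pres_lift_pi word_eval_gen. Qed.

Lemma pres_lift_morph : {morph lift : a b / a * b}.
Proof.
move=> a b; rewrite -[a]reprK -[b]reprK.
rewrite [X in lift X]pres_mulE !pres_lift_pi.
exact: word_eval_cat.
Qed.

HB.instance Definition _ :=
  isMultiplicative.Build presented_group H lift pres_lift_morph.

End Lift.
End Presentation.

Inductive fig8_gen : Type := fig8_g1 | fig8_g3.

Definition fig8_gen_bool (x : fig8_gen) : bool :=
  if x is fig8_g1 then false else true.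
Definition bool_fig8_gen (b : bool) : fig8_gen :=
  if b then fig8_g3 else fig8_g1.
Lemma fig8_gen_boolK : cancel fig8_gen_bool bool_fig8_gen.
Proof. by case. Qed.

HB.instance Definition _ := Countable.copy fig8_gen (can_type fig8_gen_boolK).

Definition fig8_rels (u v : word fig8_gen) : Prop :=
  let g1 := word_gen fig8_g1 in
  let g3 := word_gen fig8_g3 in
  let c := word_comm g3 (word_inv g1) in
  u = c ++ g3 /\ v = g1 ++ c.

Definition Gamma : Type := presented_group fig8_rels.

HB.instance Definition _ := Group.on Gamma.

Local Open Scope ring_scope.

Section SU21.
Variable R : realType.
Local Notation C := R[i].
Implicit Types (A B : 'M[C]_3) (Z W : 'cV[C]_3).

(* 0, 1 and 2 are the three elements of 'I_3 (its Z/3Z numerals), so Z k 0 is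
   the coordinate of Z with 1-based index k + 1. *)
Definition hform Z W : C :=
  Z 0 0 * (W 2 0)^*%C + Z 1 0 * (W 1 0)^*%C + Z 2 0 * (W 0 0)^*%C.

Definition preserves_hform A : Prop :=
  forall Z W, hform (A *m Z) (A *m W) = hform Z W.

Definition in_SU21 : pred 'M[C]_3 :=
  fun A => `[< \det A = 1 /\ preserves_hform A >].

Record SU21 : Type := MkSU21 { SU21_val :> 'M[C]_3; _ : in_SU21 SU21_val }.

HB.instance Definition _ := [isSub for SU21_val].
HB.instance Definition _ := [Choice of SU21 by <:].

Lemma in_SU21P A : reflect (\det A = 1 /\ preserves_hform A) (in_SU21 A).
Proof. exact: asboolP. Qed.

Lemma SU21_unit (A : SU21) : (A : 'M_3) \in unitmx.
Proof. by case: A => A /= /in_SU21P[dA _]; rewrite unitmxE dA unitr1. Qed.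

Lemma in_SU21_one : in_SU21 1%:M.
Proof. by apply/in_SU21P; rewrite det1; split=> // Z W; rewrite !mul1mx. Qed.

Lemma in_SU21_mul (A B : SU21) : in_SU21 (A *m B).
Proof.
case: A B => [A /= /in_SU21P[dA hA]] [B /= /in_SU21P[dB hB]].
apply/in_SU21P; rewrite det_mulmx dA dB mulr1; split=> // Z W.
by rewrite -!mulmxA hA hB.
Qed.

Lemma in_SU21_inv (A : SU21) : in_SU21 (invmx A).
Proof.
have uA := SU21_unit A; case: A uA => [A /= /in_SU21P[dA hA]] uA.
apply/in_SU21P; rewrite det_inv dA invr1; split=> // Z W.
by rewrite -hA !mulKVmx.
Qed.

Definition SU21_one : SU21 := MkSU21 in_SU21_one.
Definition SU21_mul (A B : SU21) : SU21 := MkSU21 (in_SU21_mul A B).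
Definition SU21_inv (A : SU21) : SU21 := MkSU21 (in_SU21_inv A).

Lemma SU21_mulA : associative SU21_mul.
Proof. by move=> A B D; apply: val_inj; rewrite /= mulmxA. Qed.
Lemma SU21_mul1 : left_id SU21_one SU21_mul.
Proof. by move=> A; apply: val_inj; rewrite /= mul1mx. Qed.
Lemma SU21_mulr1 : right_id SU21_one SU21_mul.
Proof. by move=> A; apply: val_inj; rewrite /= mulmx1. Qed.
Lemma SU21_mulV : left_inverse SU21_one SU21_inv SU21_mul.
Proof. by move=> A; apply: val_inj; rewrite /= mulVmx // SU21_unit. Qed.
Lemma SU21_mulrV : right_inverse SU21_one SU21_inv SU21_mul.
Proof. by move=> A; apply: val_inj; rewrite /= mulmxV // SU21_unit. Qed.

HB.instance Definition _ := isGroup.Build SU21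
  SU21_mulA SU21_mul1 SU21_mulr1 SU21_mulV SU21_mulrV.

Definition mx3 (a b c d e f g h k : C) : 'M[C]_3 :=
  \matrix_(i < 3, j < 3)
    nth 0 (nth [::] [:: [:: a; b; c]; [:: d; e; f]; [:: g; h; k]] i) j.

Definition rho2_mx1 : 'M[C]_3 :=
  mx3 1 1 ((- 2^-1) -i* (Num.sqrt 7 / 2))%C
      0 1 (-1)
      0 0 1.

Definition rho2_mx3 : 'M[C]_3 :=
  mx3 1    0 0
      (-1) 1 0
      ((- 2^-1) +i* (Num.sqrt 7 / 2))%C 1 1.


Let w : C := ((- 2^-1) -i* (Num.sqrt 7 / 2))%C.
Let w' : C := ((- 2^-1) +i* (Num.sqrt 7 / 2))%C.

Lemma rho2_sum : w' = - 1 - w.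
Proof. by rewrite /w /w'; simpc; congr (_ +i* _)%C; field. Qed.

Lemma rho2_sqr : w * w = - w - 2.
Proof.
have s7 : Num.sqrt 7 * Num.sqrt 7 = 7 :> R by rewrite -expr2 sqr_sqrtr.
have -> : 2 = (2 : R)%:C%C :> C by rewrite rmorph_nat.
rewrite /w; simpc.
congr (_ +i* _)%C; last by field.
by rewrite mulf_div s7; field.
Qed.

Lemma conj_w : w^*%C = w'.
Proof. by rewrite /w /w' /= opprK. Qed.

Lemma conj_w' : w'^*%C = w.
Proof. by []. Qed.

Lemma conjcD (x y : C) : (x + y)^*%C = x^*%C + y^*%C.
Proof. exact: (rmorphD (@conjc R)). Qed.
Lemma conjcM (x y : C) : (x * y)^*%C = x^*%C * y^*%C.
Proof. exact: (rmorphM (@conjc R)). Qed.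
Lemma conjcN (x : C) : (- x)^*%C = - x^*%C.
Proof. exact: (rmorphN (@conjc R)). Qed.
Lemma conjc01 : (0^*%C = 0 :> C) * (1^*%C = 1 :> C).
Proof. by split; [exact: (rmorph0 (@conjc R)) | exact: (rmorph1 (@conjc R))]. Qed.
Definition conjcE := (conjcD, conjcM, conjcN, conjc01).

Lemma mx3_mul a b c d e f g h k a' b' c' d' e' f' g' h' k' :
  mx3 a b c d e f g h k *m mx3 a' b' c' d' e' f' g' h' k' =
  mx3 (a * a' + b * d' + c * g') (a * b' + b * e' + c * h')
      (a * c' + b * f' + c * k')
      (d * a' + e * d' + f * g') (d * b' + e * e' + f * h')
      (d * c' + e * f' + f * k')
      (g * a' + h * d' + k * g') (g * b' + h * e' + k * h')
      (g * c' + h * f' + k * k').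
Proof.
apply/matrixP=> -[[|[|[|//]]] ?] [[|[|[|//]]] ?];
  by rewrite !mxE !big_ord_recl big_ord0 !mxE /= addr0 addrA.
Qed.

Lemma mx3_1 : mx3 1 0 0 0 1 0 0 0 1 = 1%:M.
Proof. by apply/matrixP=> -[[|[|[|//]]] ?] [[|[|[|//]]] ?]; rewrite !mxE. Qed.

Lemma mx3_mulv a b c d e f g h k (Z : 'cV[C]_3) :
  let A := mx3 a b c d e f g h k in
  [/\ (A *m Z) 0 0 = a * Z 0 0 + b * Z 1 0 + c * Z 2 0,
      (A *m Z) 1 0 = d * Z 0 0 + e * Z 1 0 + f * Z 2 0 &
      (A *m Z) 2 0 = g * Z 0 0 + h * Z 1 0 + k * Z 2 0].
Proof.
have e0 : ord0 = 0 :> 'I_3 by apply/val_inj.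
have e1 : lift ord0 ord0 = 1 :> 'I_3 by apply/val_inj.
have e2 : lift ord0 (lift ord0 ord0) = 2 :> 'I_3 by apply/val_inj.
by split; rewrite !mxE !big_ord_recl big_ord0 e0 e1 e2 !mxE /= addr0 addrA.
Qed.

Lemma rho2_mx1_SU21 : in_SU21 rho2_mx1.
Proof.
apply/in_SU21P; split.
  rewrite -det_tr det_trig; last first.
    by apply/is_trig_mxP=> -[[|[|[|//]]] ?] [[|[|[|//]]] ?]; rewrite ?mxE.
  by rewrite !big_ord_recl big_ord0 !mxE /= !mulr1.
move=> Z W; rewrite /hform.
have [-> -> ->] := mx3_mulv 1 1 w 0 1 (-1) 0 0 1 Z.
have [-> -> ->] := mx3_mulv 1 1 w 0 1 (-1) 0 0 1 W.
rewrite !conjcE conj_w rho2_sum.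
by ring.
Qed.

Lemma rho2_mx3_SU21 : in_SU21 rho2_mx3.
Proof.
apply/in_SU21P; split.
  rewrite det_trig; last first.
    by apply/is_trig_mxP=> -[[|[|[|//]]] ?] [[|[|[|//]]] ?]; rewrite ?mxE.
  by rewrite !big_ord_recl big_ord0 !mxE /= !mulr1.
move=> Z W; rewrite /hform.
have [-> -> ->] := mx3_mulv 1 0 0 (-1) 1 0 w' 1 1 Z.
have [-> -> ->] := mx3_mulv 1 0 0 (-1) 1 0 w' 1 1 W.
rewrite !conjcE conj_w' rho2_sum.
by ring.
Qed.

Definition rho2_gen (x : fig8_gen) : SU21 :=
  match x with
  | fig8_g1 => MkSU21 rho2_mx1_SU21
  | fig8_g3 => MkSU21 rho2_mx3_SU21
  end.

Lemma invmx_eq A B : A *m B = 1%:M -> invmx A = B.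
Proof.
move=> AB; have [uA _] := mulmx1_unit AB.
by rewrite -[LHS]mulmx1 -AB mulKmx.
Qed.

Lemma rho2_mx1V : invmx rho2_mx1 = mx3 1 (-1) w' 0 1 1 0 0 1.
Proof.
apply: invmx_eq; rewrite mx3_mul -mx3_1 -/w rho2_sum.
by congr mx3; ring.
Qed.

Lemma rho2_mx3V : invmx rho2_mx3 = mx3 1 0 0 1 1 0 w (-1) 1.
Proof.
apply: invmx_eq; rewrite mx3_mul -mx3_1 -/w' rho2_sum.
by congr mx3; ring.
Qed.

Lemma rho2_rels : respects_rels fig8_rels rho2_gen.
Proof.
move=> _ _ [-> ->]; rewrite [LHS]word_eval_cat [RHS]word_eval_cat.
rewrite word_eval_comm (word_eval_inv _ (word_gen fig8_g1)) !word_eval_gen.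
rewrite /comm invgK; apply: val_inj.
change (rho2_mx3 *m invmx rho2_mx1 *m invmx rho2_mx3 *m rho2_mx1 *m rho2_mx3
  = rho2_mx1 *m
    (rho2_mx3 *m invmx rho2_mx1 *m invmx rho2_mx3 *m rho2_mx1)).
rewrite rho2_mx1V rho2_mx3V !mx3_mul -/w -/w' rho2_sum.
have w2 := rho2_sqr.
by congr mx3; ring: w2.
Qed.

Definition rho2 : Gamma -> SU21 := pres_lift rho2_rels.

HB.instance Definition _ := Multiplicative.on rho2.

Definition gamma_gen (x : fig8_gen) : Gamma := pres_gen fig8_rels x.

Lemma rho2_g1 : rho2 (gamma_gen fig8_g1) = rho2_mx1 :> 'M[C]_3.
Proof. by rewrite /rho2 pres_lift_gen. Qed.

Lemma rho2_g3 : rho2 (gamma_gen fig8_g3) = rho2_mx3 :> 'M[C]_3.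
Proof. by rewrite /rho2 pres_lift_gen. Qed.

End SU21.

(* Main.v *)
Require Import Defs.
From mathcomp Require Import all_boot all_order all_algebra.
From mathcomp Require Import classical_sets functions reals.
From mathcomp Require Import cardinality complex ring.

Local Open Scope classical_set_scope.

(** Modulo commutators a = rho2(g1) and b = rho2(g3) agree, because the
    relation c b = a c, with c = [b, a^-1], makes them conjugate.  So x = [a, b] a
    generates the abelianization of the image.  A matrix computation gives
    x^3 = 1. *)

Set Implicit Arguments.
Unset Strict Implicit.
Unset Printing Implicit Defensive.

Local Open Scope group_scope.
Local Open Scope card_scope.

Section Commutators.
Variables (G : groupType) (K : set G).
Hypothesis sgK : is_subgroup K.
Implicit Types (x y : G) (L : set G).

Lemma subgroupM L x y : is_subgroup L -> L x -> L y -> L (x * y).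
Proof.
move=> /is_subgroupP[L1 Ldiv] Lx Ly; rewrite -[y]invgK -[y^-1]mul1g.
by apply: (Ldiv _ _ Lx); apply: Ldiv.
Qed.

Lemma subgroupV L x : is_subgroup L -> L x -> L x^-1.
Proof.
by move=> /is_subgroupP[L1 Ldiv] Lx; rewrite -(mul1g x^-1); apply: Ldiv.
Qed.

Lemma subgroup1 L : is_subgroup L -> L 1.
Proof. by case/is_subgroupP. Qed.

Lemma subgroupX L x n : is_subgroup L -> L x -> L (x ^+ n).
Proof.
move=> sgL Lx; elim: n => [|n IHn]; first by rewrite expg0; apply: subgroup1.
by rewrite expgS; apply: subgroupM.
Qed.

Lemma subgroup_gen_subgroup (A : set G) : is_subgroup (subgroup_gen A).
Proof.
apply/is_subgroupP; split=> [L [/subgroup1 //]|x y Ax Ay L [sgL AL]].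
have /is_subgroupP[_ Ldiv] := sgL.
by apply: Ldiv; [apply: Ax | apply: Ay].
Qed.

Lemma mem_commutator_subgroup x y :
  K x -> K y -> commutator_subgroup K (comm x y).
Proof. by move=> Kx Ky L [_]; apply; exists (x, y). Qed.

Lemma commJ x y z : z * comm x y * z^-1 = comm (z * x * z^-1) (z * y * z^-1).
Proof. by rewrite /comm !invgM !invgK !mulgA !mulgVK. Qed.

Lemma commutator_subgroup_normal : normal_subgroup (commutator_subgroup K) K.
Proof.
have sgN : is_subgroup (commutator_subgroup K) by exact: subgroup_gen_subgroup.
have KJ x y : K x -> K y -> K (x * y * x^-1).
  by move=> Kx Ky; do !apply: subgroupM => //; apply: subgroupV.
split=> // [|x y Kx].
  apply: smallest_sub => // _ [[x y] [/= Kx Ky] <-].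
  by rewrite /comm; do !apply: subgroupM => //; apply: subgroupV.
(* [L] collects the elements whose conjugate by [x] stays in the commutator subgroup. It is a
   subgroup containing every commutator, so it contains the smallest such subgroup. *)
pose L := [set y | commutator_subgroup K (x * y * x^-1)].
suff: commutator_subgroup K `<=` L by apply.
apply: smallest_sub => [|_ [[u v] [/= Ku Kv] <-]]; last first.
  by rewrite /L /= commJ; apply: (mem_commutator_subgroup (KJ _ _ Kx Ku) (KJ _ _ Kx Kv)).
apply/is_subgroupP; split=> [|u v]; rewrite /L /=.
  by rewrite mulg1 mulgV; apply: (subgroup1 sgN).
have -> : x * (u * v^-1) * x^-1 = (x * u * x^-1) * (x * v * x^-1)^-1.
  by rewrite !invgM invgK !mulgA mulgVK.
by move=> Lu Lv; apply: (subgroupM sgN Lu); apply: (subgroupV sgN).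
Qed.

End Commutators.

Section Index.
Variables (G : groupType) (K N : set G) (x : G) (n : nat).
Hypotheses (sgK : is_subgroup K) (nNK : normal_subgroup N K).
Hypotheses (Kx : K x) (xn1 : x ^+ n.+1 = 1).

(** Membership of [x ^- i * h] in [N] says that [h] lies in the coset of [x ^+ i]. Normality allows
    the [N]-part of [h] to be conjugated past [x ^- j], so exponents add. *)
Lemma normal_powM (h k : G) (i j : nat) :
  N (x ^- i * h) -> N (x ^- j * k) -> N (x ^- (i + j) * (h * k)).
Proof.
case: nNK => _ sgN _ NJ Nh Nk.
have -> : x ^- (i + j) * (h * k) =
          (x ^- j * (x ^- i * h) * (x ^- j)^-1) * (x ^- j * k).
  by rewrite expgnDr invgM invgK !mulgA mulgK.
apply: subgroupM => //; apply: NJ => //.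
by apply: subgroupV => //; apply: subgroupX.
Qed.

(** Since [x ^+ n] is the inverse of [x], inverting [h] still gives a natural exponent, namely
    [n]. *)
Lemma normal_powV (h : G) : N (x^-1 * h) -> N (x ^- n * h^-1).
Proof.
case: nNK => _ sgN _ NJ Nh.
have -> : x ^- n = x by apply: mulg1_eq; rewrite -expgSr.
have -> : x * h^-1 = (x * (x^-1 * h) * x^-1)^-1.
  by rewrite !invgM invgK !mulgA mulgK.
by apply: subgroupV => //; apply: NJ.
Qed.

(** Induction on the word: a positive letter adds 1 to the exponent, an inverse letter adds [n]. *)
Lemma word_eval_pow (X : choiceType) (f : X -> G) (u : word X) :
  (forall i, N (x^-1 * f i)) -> exists m : nat, N (x ^- m * word_eval f u).
Proof.
case: nNK => _ sgN _ _ Nf; elim: u => [|[i b] u [m IHu]].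
  by exists 0%N; rewrite expg0 mulg1 invg1; apply: subgroup1.
case: b; first by exists (1 + m)%N; apply: normal_powM; rewrite ?expg1.
by exists (n + m)%N; apply: normal_powM => //=; apply: normal_powV.
Qed.

(** Exponents matter only modulo [n.+1], so the cosets of [x ^+ i] for [i < n.+1] exhaust all left
    cosets. *)
Lemma index_at_most_pow :
  (forall k, K k -> exists m : nat, N (x ^- m * k)) -> index_at_most K N n.+1.
Proof.
case: nNK => _ sgN _ _ Kpow.
apply: card_le_trans (card_image_le (fun i => [set x ^+ i * y | y in N]) `I_n.+1).
apply: subset_card_le => _ [k /Kpow[m Nmk] <-]; exists (m %% n.+1)%N.
  exact: ltn_pmod.
have {Nmk} : N (x ^- (m %% n.+1) * k).
  move: Nmk; rewrite {1}(divn_eq m n.+1) expgnDr mulnC expgnA xn1.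
  by rewrite expg1n mul1g.
(* As [z^-1 * k] is in [N], the cosets of [z] and [k] coincide; both inclusions follow. *)
move: (x ^+ _) => z Nzk; apply/seteqP; split=> _ [y Ny <-].
  exists ((z^-1 * k)^-1 * y); last by rewrite invgM invgK mulgA mulVKg.
  by apply: subgroupM => //; apply: subgroupV.
by exists (z^-1 * k * y); [apply: subgroupM | rewrite !mulgA mulgV mul1g].
Qed.

End Index.

Section Image.
Variable R : realType.
Local Notation a := (rho2_gen R fig8_g1).
Local Notation b := (rho2_gen R fig8_g3).

(** Describing the image by words instead of classes in [Gamma] makes induction on words
    available. *)
Lemma range_rho2 : range (rho2 R) = range (word_eval (@rho2_gen R)).
Proof.
apply/seteqP; split=> _ [u _ <-]; first by exists (generic_quotient.repr u).
exists (generic_quotient.pi (presented_group fig8_rels) u) => //.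
exact: pres_lift_pi.
Qed.

Lemma range_rho2_subgroup : is_subgroup (range (rho2 R)).
Proof.
rewrite range_rho2; apply/is_subgroupP; split=> [|_ _ [u _ <-] [v _ <-]].
  by exists [::].
by exists (u ++ word_inv v) => //; rewrite word_eval_cat word_eval_inv.
Qed.

Lemma range_rho2_gen i : range (rho2 R) (rho2_gen R i).
Proof. by rewrite range_rho2; exists (word_gen i) => //; apply: word_eval_gen. Qed.

Lemma rho2_gen_rel : comm b a^-1 * b = a * comm b a^-1.
Proof.
have := rho2_rels R (conj erefl erefl).
rewrite [X in X = _]word_eval_cat [X in _ = X]word_eval_cat word_eval_comm.
by rewrite (word_eval_inv _ (word_gen fig8_g1)) !word_eval_gen.
Qed.

Lemma rho2_commM_mx :
  let w : R[i] := ((- 2^-1)%R -i* (Num.sqrt 7 / 2)%R)%C in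
  \val (comm a b * a) = mx3 1%R (1 + w)%R (-1)%R w (-1)%R 0%R (-1)%R 0%R 0%R.
Proof.
move=> w.
change (rho2_mx1 R *m rho2_mx3 R *m invmx (rho2_mx1 R) *m invmx (rho2_mx3 R)
        *m rho2_mx1 R = mx3 1 (1 + w) (-1) w (-1) 0 (-1) 0 0)%R.
rewrite rho2_mx1V rho2_mx3V !mx3_mul rho2_sum -/w.
(* The only fact about [w] needed from here is [w * w = - w - 2], so its value is abstracted
   away. *)
by have := rho2_sqr R; rewrite -/w; move: w => w w2; congr mx3; ring: w2.
Qed.

(** The matrix has trace 0, and an element of SU(2,1) with trace t has characteristic polynomial X^3
    - t X^2 + conj(t) X - 1, here X^3 - 1. The proof cubes the matrix directly. *)
Lemma rho2_commM_order3 : (comm a b * a) ^+ 3 = 1.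
Proof.
apply: val_inj; rewrite !expgS expg0 mulg1.
set x := comm a b * a.
change (\val x *m (\val x *m \val x) = 1%:M)%R.
rewrite rho2_commM_mx !mx3_mul -mx3_1.
have := rho2_sqr R; move: (_ -i* _)%C => w w2.
by congr mx3; ring: w2.
Qed.

End Image.

Theorem corollary11 (R : realType) :
  let G : set (SU21 R) := range (rho2 R) in
  normal_subgroup (commutator_subgroup G) G /\
  index_at_most G (commutator_subgroup G) 3.
Proof.
move=> G; have sgG : is_subgroup G := range_rho2_subgroup R.
have nNG := commutator_subgroup_normal sgG; split=> //.
have [_ sgN NG _] := nNG.
have Ga : G (rho2_gen R fig8_g1) := range_rho2_gen R fig8_g1.
have Gb : G (rho2_gen R fig8_g3) := range_rho2_gen R fig8_g3.
have ab := rho2_gen_rel R; have x3 := rho2_commM_order3 R.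
have GaV := subgroupV sgG Ga.
set a := rho2_gen R fig8_g1 in Ga GaV ab x3.
set b := rho2_gen R fig8_g3 in Gb ab x3.
(* The matrix [a] is unipotent of infinite order; the factor [comm a b] replaces it by an element
   with the same class modulo commutators whose cube is 1. *)
set x := comm a b * a in x3.
have Nab : commutator_subgroup G (comm a b).
  exact: mem_commutator_subgroup Ga Gb.
have Gx : G x by apply: (subgroupM sgG (NG _ Nab) Ga).
have Gc : G (comm b a^-1) by exact: NG _ (mem_commutator_subgroup Gb GaV).
have Nxa : commutator_subgroup G (x^-1 * a).
  have [_ _ _ NJ] := nNG.
  (* [x^-1 * a] is the conjugate of [(comm a b)^-1] by [a^-1]. *)
  rewrite /x invgM -{1}[a in _ * a]invgK; apply: NJ => //.
  exact: subgroupV sgN Nab.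
apply: (index_at_most_pow nNG x3) => k.
rewrite {1}/G range_rho2 => -[u _ <-].
(* It suffices that both generators lie in the coset of [x]; for [a] this is [Nxa], which leaves
   [b]. *)
apply: (word_eval_pow sgG nNG Gx x3) => -[] //.
set c := comm b a^-1 in ab Gc.
(* The relation [c * b = a * c] gives [b = c^-1 * a * c], hence [a^-1 * b = comm a^-1 c^-1]. *)
have -> : x^-1 * b = x^-1 * a * comm a^-1 c^-1.
  by rewrite /comm !invgK -(mulKg c b) ab !mulgA mulgK.
apply: (subgroupM sgN Nxa).
exact: mem_commutator_subgroup GaV (subgroupV sgG Gc).
Qed.
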